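(* Let $\mathbb{S}^1$ be the unit circle with the metric inherited from the line. The map $\mathrm{mdim}_M: C^0(\mathbb{S}^1)\to\mathbb{R}$, $\phi\mapsto \mathrm{mdim}_M(\mathbb{S}^1,\phi,|\cdot|)$, is not continuous anywhere; that is, it is discontinuous at every $\phi\in C^0(\mathbb{S}^1)$. (This is asserted both for the lower metric mean dimension $\underline{\mathrm{mdim}_M}$ and for the upper metric mean dimension $\overline{\mathrm{mdim}_M}$.)
   Context: The circle is $\mathbb{S}^1=\mathbb{R}/\mathbb{Z}$ with the quotient (arc-length) metric, denoted $|\cdot|$. For a compact metric space $(X,d)$, $C^0(X)$ is the set of continuous maps $X\to X$ with the uniform metric $d(\phi,\varphi)=\max_{x\in X}d(\phi(x),\varphi(x))$. For $\phi\in C^0(X)$ and $n\ge1$ let $d_n(x,y)=\max_{0\le j\le n-1}d(\phi^j(x),\phi^j(y))$. A set $A\subset X$ is $(n,\phi,\varepsilon)$-separated if $d_n(x,y)>\varepsilon$ for all distinct $x,y\in A$; $\mathrm{sep}(n,\phi,\varepsilon)$ is the maximal cardinality of such a set, and $\mathrm{sep}(\phi,\varepsilon)=\limsup_{n\to\infty}\frac1n\log \mathrm{sep}(n,\phi,\varepsilon)$. The lower and upper metric mean dimensions are $$\underline{\mathrm{mdim}_M}(X,\phi,d)=\liminf_{\varepsilon\to0}\frac{\mathrm{sep}(\phi,\varepsilon)}{|\log\varepsilon|},\qquad \overline{\mathrm{mdim}_M}(X,\phi,d)=\limsup_{\varepsilon\to0}\frac{\mathrm{sep}(\phi,\varepsilon)}{|\log\varepsilon|}.$$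 The symbol $\mathrm{mdim}_M$ without underline or overline means that the assertion holds for each of the two. For $X=\mathbb{S}^1$ both take values in $[0,1]$. *)

(* Defs.v *)
From HB Require Import structures.
From mathcomp Require Import all_boot all_order all_algebra.
From mathcomp Require Import all_classical all_reals all_analysis.
From mathcomp Require Import lra.

Set Implicit Arguments.
Unset Strict Implicit.
Unset Printing Implicit Defensive.

Import Order.TTheory GRing.Theory Num.Theory.
Import numFieldNormedType.Exports.

Local Open Scope classical_set_scope.
Local Open Scope ring_scope.
Local Open Scope quotient_scope.

Section metric_mean_dimension.
Context {R : realType} {X : metricType R}.
Implicit Types (phi : X -> X) (n : nat) (eps : R) (A : set X).

(* The neutral element 0 of the maximum is harmless, as distances are
   nonnegative. *)
Definition bowen_dist phi n (x y : X) : R :=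
  \big[Num.max/0]_(j < n) mdist (iter j phi x) (iter j phi y).

Definition separated phi n eps A : Prop :=
  forall x y, A x -> A y -> x <> y -> eps < bowen_dist phi n x y.

(* counting A is the cardinality of A, +oo if A is infinite; on a compact space
   this supremum is a maximum. *)
Definition sep_card phi n eps : \bar R :=
  ereal_sup [set counting A | A in separated phi n eps].

(* The term of index n = 0 does not affect the limit superior. *)
Definition sep_rate phi eps : \bar R :=
  limn_esup (fun n => (n%:R^-1)%:E * lne (sep_card phi n eps))%E.

Definition lower_mdim phi : \bar R :=
  limf_einf (fun eps => sep_rate phi eps * (`|ln eps|^-1)%:E)%E 0^'+.

Definition upper_mdim phi : \bar R :=
  limf_esup (fun eps => sep_rate phi eps * (`|ln eps|^-1)%:E)%E 0^'+.

End metric_mean_dimension.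

Section circle.
Variable R : realType.

(* R / Z *)
Definition circle : Type :=
  Quotient.quot (GRing.ZmodClosed.clone R Num.int_num_subdef _).

HB.instance Definition _ := Choice.on circle.
HB.instance Definition _ := GRing.Zmodule.on circle.
HB.instance Definition _ := Quotient.on circle.

(* The quotient metric: the distance between two cosets of Z. *)
Definition circle_dist (p q : circle) : R :=
  inf [set `|x - y| | x in [set x | \pi_circle x = p]
                    & y in [set y | \pi_circle y = q]].

Lemma circle_piP (x y : R) :
  \pi_circle x = \pi_circle y <-> x - y \is a Num.int.
Proof.
have := Quotient.idealrBE (GRing.ZmodClosed.clone R Num.int_num_subdef _) x y.
by move=> h; split=> [/eqP|xy]; [|apply/eqP]; rewrite -h.
Qed.

Lemma circle_dist_le (x y : R) :
  circle_dist (\pi_circle x) (\pi_circle y) <= `|x - y|.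
Proof.
by apply: ge_inf; [exists 0 => _ [? _ [? _ <-]]|exists x => //; exists y].
Qed.

Lemma circle_dist_lt (x : R) (q : circle) (e : R) :
  circle_dist (\pi_circle x) q < e ->
  exists2 y, \pi_circle y = q & `|x - y| < e.
Proof.
case/inf_lt => [|_ [u /= ux [v /= vq <-]] uve].
  by exists `|x - repr q|, x => //; exists (repr q) => //=; exact: reprK.
exists (v + (x - u)); last by have -> : x - (v + (x - u)) = u - v by lra.
rewrite -vq; apply/circle_piP; rewrite addrAC subrr add0r.
by apply/circle_piP; rewrite ux.
Qed.

Lemma circle_dist_ge0 (p q : circle) : 0 <= circle_dist p q.
Proof.
apply: lb_le_inf => [|_ [? _ [? _ <-]] //].
by exists `|repr p - repr q|, (repr p); rewrite /= ?reprK//;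
  exists (repr q); rewrite /= ?reprK.
Qed.

Lemma circle_distxx (p : circle) : circle_dist p p = 0.
Proof.
apply/le_anti; rewrite circle_dist_ge0 andbT -[p]reprK.
by apply: le_trans (circle_dist_le _ _) _; rewrite subrr normr0.
Qed.

Lemma circle_dist_positivity (p q : circle) : circle_dist p q = 0 -> p = q.
Proof.
rewrite -{1}[p]reprK => pq0.
have [|y yq xy] := @circle_dist_lt (repr p) q 2^-1.
  by rewrite pq0 invr_gt0.
have [/eqP|s0] := eqVneq (`|repr p - y|) 0.
  by rewrite normr_eq0 subr_eq0 => /eqP xyE; rewrite -[p]reprK xyE yq.
have [|z zq xz] := @circle_dist_lt (repr p) q `|repr p - y|.
  by rewrite pq0 lt_neqAle eq_sym s0 /=.
have yzZ : y - z \is a Num.int by apply/circle_piP; rewrite yq zq.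
have [/eqP|yz0] := eqVneq (y - z) 0.
  by rewrite subr_eq0 => /eqP yzE; move: xz; rewrite yzE ltxx.
exfalso; have := norm_intr_ge1 yzZ yz0.
have := ler_normD (y - repr p) (repr p - z); rewrite subrKA (distrC y (repr p)).
by move: xy xz; clear; lra.
Qed.

Lemma circle_dist_sym (p q : circle) : circle_dist p q = circle_dist q p.
Proof.
by congr inf; apply/seteqP; split => _ [x xp [y yq <-]];
  exists y => //; exists x => //; rewrite distrC.
Qed.

Lemma circle_dist_triangle (q p r : circle) :
  circle_dist p r <= circle_dist p q + circle_dist q r.
Proof.
apply/ler_addgt0Pl => e e0; rewrite -[p]reprK.
have [|y yq xy] :=
  @circle_dist_lt (repr p) q (circle_dist (\pi_circle (repr p)) q + e / 2).
  by rewrite ltrDl divr_gt0.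
have [|z zr yz] :=
  @circle_dist_lt y r (circle_dist q r + e / 2).
  by rewrite yq ltrDl divr_gt0.
have := circle_dist_le (repr p) z; rewrite zr.
have := ler_normD (repr p - y) (y - z); rewrite subrKA.
by move: xy yz; clear; lra.
Qed.

HB.instance Definition _ := isMetric.Build R circle
  circle_distxx circle_dist_positivity circle_dist_sym circle_dist_triangle.

Lemma circle_dist_le1 (p q : circle) : circle_dist p q <= 1.
Proof.
rewrite -[p]reprK -[q]reprK; set x := repr p; set y := repr q.
have -> : \pi_circle y = \pi_circle (y + (Num.floor (x - y))%:~R).
  by apply/circle_piP; rewrite opprD addrA subrr add0r rpredN intr_int.
apply: le_trans (circle_dist_le _ _) _; rewrite opprD addrA ger0_norm.
  by have := lt_succ_floor (x - y); rewrite intrD; lra.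
by rewrite subr_ge0 ge_floor.
Qed.

Definition C0_circle : Type := continuousType circle circle.

HB.instance Definition _ := Choice.on C0_circle.

(* By compactness of the circle, this supremum is a maximum. *)
Definition C0_dist (f g : C0_circle) : R :=
  sup [set mdist (f x) (g x) | x in [set: circle]].

Lemma C0_dist_ub (f g : C0_circle) (x : circle) :
  mdist (f x) (g x) <= C0_dist f g.
Proof.
by apply: ub_le_sup; [exists 1 => _ [y _ <-]; exact: circle_dist_le1|exists x].
Qed.

Lemma C0_dist_lub (f g : C0_circle) (e : R) :
  (forall x, mdist (f x) (g x) <= e) -> C0_dist f g <= e.
Proof.
by move=> fge; apply: ge_sup => [|_ [x _ <-]//]; exists (mdist (f 0) (g 0)), 0.
Qed.

Lemma C0_distxx (f : C0_circle) : C0_dist f f = 0.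
Proof.
apply/le_anti/andP; split; first by apply: C0_dist_lub => x; rewrite mdistxx.
by apply: le_trans (C0_dist_ub f f 0); exact: mdist_ge0.
Qed.

Lemma C0_dist_positivity (f g : C0_circle) : C0_dist f g = 0 -> f = g.
Proof.
move=> fg0; apply/continuousEP => x; apply/(@mdist_positivity R).
by apply/le_anti; rewrite mdist_ge0 andbT -fg0; exact: C0_dist_ub.
Qed.

Lemma C0_dist_sym (f g : C0_circle) : C0_dist f g = C0_dist g f.
Proof. by congr sup; apply: eq_imagel => x _; rewrite metric_sym. Qed.

Lemma C0_dist_triangle (g f h : C0_circle) :
  C0_dist f h <= C0_dist f g + C0_dist g h.
Proof.
apply: C0_dist_lub => x; apply: le_trans (metric_triangle _ (g x) _) _.
by rewrite lerD// C0_dist_ub.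
Qed.

HB.instance Definition _ := isMetric.Build R C0_circle
  C0_distxx C0_dist_positivity C0_dist_sym C0_dist_triangle.

End circle.

(* Main.v *)
(* For a Lipschitz map the number of separated orbits of length n grows like
   L^n / eps, so its upper metric mean dimension is at most 0. It therefore
   suffices to approximate a given circle map phi uniformly both by Lipschitz maps
   and by maps of lower metric mean dimension at least 1/4.

   Let f be Lipschitz, close to phi, send the grid of mesh 1/m to itself and be
   constant on the first half of each grid cell. Let w : [0, 1/4] -> [0, 1/4]
   carry, for every k, a sawtooth with 2^(k+2) teeth on [2^-(k+4), 2^-(k+3)], each
   tooth covering this whole interval, and put g = f + w(t)/m at the point u + t/m
   right of a grid point u. Then g acts as u + t/m |-> f(u) + w(t)/m, so that along
   the grid orbit of u every itinerary through the teeth of scale k is realised.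
   This gives at least 2^((k+2)n) orbits of length n that are separated at a scale
   of order 4^-k / m, whatever the dynamics of f on the grid; hence no periodic
   point of phi is needed. *)
Require Import Defs.
From HB Require Import structures.
From mathcomp Require Import all_boot all_order all_algebra.
From mathcomp Require Import all_classical all_reals all_analysis.
From mathcomp Require Import finmap ring lra.

Set Implicit Arguments.
Unset Strict Implicit.
Unset Printing Implicit Defensive.

Import Order.TTheory GRing.Theory Num.Theory.
Import numFieldNormedType.Exports.

Local Open Scope classical_set_scope.
Local Open Scope ring_scope.
Local Open Scope quotient_scope.

(** * Geometry of the circle: translation invariance, lifts and uniform continuity *)

Section circle_geometry.
Variable R : realType.
Local Notation pi := (\pi_(circle R)).
Implicit Types (x y t : R) (p q c : circle R).

Lemma circle_piD x y : pi (x + y) = pi x + pi y.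
Proof. exact: raddfD. Qed.

Lemma circle_piB x y : pi (x - y) = pi x - pi y.
Proof. exact: raddfB. Qed.

Lemma circle_pi0 : pi 0 = 0.
Proof. exact: raddf0. Qed.

Lemma circle_piMn x n : pi (x *+ n) = pi x *+ n.
Proof. exact: raddfMn. Qed.

Lemma circle_pi_int x : x \is a Num.int -> pi x = 0.
Proof. by move=> xZ; rewrite -circle_pi0; apply/circle_piP; rewrite subr0. Qed.

Lemma circle_mdist_lt p q (e : R) : mdist p q < e ->
  exists x y, [/\ pi x = p, pi y = q & `|x - y| < e].
Proof.
move=> pqe; have [|y yq xy] := @circle_dist_lt R (repr p) q e.
  by rewrite reprK.
by exists (repr p), y; rewrite reprK.
Qed.

Lemma circle_mdistDr c p q : mdist (p + c) (q + c) = mdist p q.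
Proof.
wlog suff le : c p q / mdist (p + c) (q + c) <= mdist p q.
  apply/le_anti; rewrite le//=.
  by have := le (- c) (p + c) (q + c); rewrite !addrK.
apply/ler_addgt0Pr => e e0.
have [|x [y [xp yq xy]]] := @circle_mdist_lt p q (mdist p q + e).
  by rewrite ltrDl.
rewrite -xp -yq -[c]reprK -!circle_piD xp yq.
apply: le_trans (circle_dist_le _ _) (ltW _).
by rewrite opprD addrACA subrr addr0.
Qed.

Lemma circle_mdistDl c p q : mdist (c + p) (c + q) = mdist p q.
Proof. by rewrite ![c + _]addrC circle_mdistDr. Qed.

Lemma circle_mdistD p q p' q' :
  mdist (p + q) (p' + q') <= mdist p p' + mdist q q'.
Proof.
apply: le_trans (metric_triangle _ (p' + q) _) _.
by rewrite circle_mdistDr circle_mdistDl.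
Qed.

Lemma circle_mdist_pi x y : mdist (pi x) (pi y) <= `|x - y|.
Proof. exact: circle_dist_le. Qed.

(** A representative of [pi y] closer to [x] than [y] would differ from [y] by a nonzero integer,
    while lying at distance less than 1 from it. *)
Lemma circle_mdist_pi_small x y : `|x - y| <= 2^-1 ->
  mdist (pi x) (pi y) = `|x - y|.
Proof.
move=> xy2; apply/le_anti; rewrite circle_mdist_pi/= leNgt; apply/negP.
case/circle_dist_lt => z /circle_piP zyZ xz.
have [/eqP|zy0] := eqVneq (z - y) 0.
  by rewrite subr_eq0 => /eqP zy; rewrite zy ltxx in xz.
have := norm_intr_ge1 zyZ zy0.
have := ler_normD (z - x) (x - y); rewrite subrKA (distrC z x).
by move: xy2 xz; clear; lra.
Qed.

Lemma circle_mdistMn n p q : mdist (p *+ n) (q *+ n) <= mdist p q *+ n.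
Proof.
elim: n => [|n IH]; first by rewrite mdistxx.
by rewrite !mulrS (le_trans (circle_mdistD _ _ _ _))// lerD2l.
Qed.

Lemma circle_mdist0_lip p q : `|mdist p 0 - mdist q 0| <= mdist p q.
Proof.
have := metric_triangle p q 0; have := metric_triangle q p 0.
by rewrite (metric_sym q p) ler_norml; lra.
Qed.

Lemma circle_pi_01 p : exists2 x, 0 <= x < 1 & pi x = p.
Proof.
exists (repr p - (Num.floor (repr p))%:~R).
  by rewrite subr_ge0 ge_floor/=; have := lt_succ_floor (repr p); rewrite intrD; lra.
by rewrite circle_piB (circle_pi_int (intr_int _ _)) subr0 reprK.
Qed.

(** Heine-Cantor, with compactness taken from the segment [[0, 1]], which projects onto the
    circle. *)
Lemma circle_unif_continuous (f : circle R -> circle R) (e : R) :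
  continuous f -> 0 < e ->
  exists2 d, 0 < d & forall p q, mdist p q < d -> mdist (f p) (f q) < e.
Proof.
move=> fc e0.
pose P (d : R) (x : R) := forall q, mdist (pi x) q < d ->
  mdist (f (pi x)) (f q) < e.
have : \forall d \near 0^'+, `[0, 1] `<=` P d.
  have /compact_near_coveringP/(_ R 0^'+ P) := @segment_compact R 0 1.
  apply => x _.
  have /nbhs_ballP[r /= r0 rf] : nbhs (pi x) [set q | mdist (f (pi x)) (f q) < e / 2].
    have := fc (pi x) (ball (f (pi x)) (e / 2)).
    rewrite ballEmdist; apply; rewrite -ballEmdist; apply: nbhsx_ballx.
    by rewrite divr_gt0.
  rewrite ballEmdist in rf.
  exists (ball x (r / 2), [set d | d < r / 2]) => /=.
    split; first by apply: nbhsx_ballx; rewrite divr_gt0.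
    by apply: nbhs_right_lt; rewrite divr_gt0.
  move=> [y d] /= [xy dr] q yqd.
  have xyr : mdist (pi x) (pi y) < r / 2 by exact: le_lt_trans (circle_mdist_pi _ _) xy.
  have h1 : mdist (f (pi x)) (f (pi y)) < e / 2.
    by apply: rf => /=; move: xyr r0; clear; lra.
  have h2 : mdist (f (pi x)) (f q) < e / 2.
    apply: rf => /=; have := metric_triangle (pi x) (pi y) q.
    by move: xyr yqd dr; clear; lra.
  have := metric_triangle (f (pi y)) (f (pi x)) (f q).
  by rewrite (metric_sym (f (pi y)) (f (pi x))); move: h1 h2; clear; lra.
move=> /nbhs_ballP[r /= r0 rP].
exists (r / 2); first by rewrite divr_gt0.
move=> p q; have [x x01 <-] := circle_pi_01 p; apply: rP => /=.
- by rewrite /ball/= sub0r normrN gtr0_norm ?divr_gt0//; move: r0; clear; lra.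
- by rewrite divr_gt0.
- by rewrite in_itv/=; case/andP: x01 => -> /ltW.
Qed.

Definition mk_C0_circle (f : circle R -> circle R) (fc : continuous f) : C0_circle R :=
  HB.pack f (isContinuous.Build _ _ f fc).

End circle_geometry.

(** * Cardinality estimates for [counting] *)

Section counting_cardinality.
Variable (R : realType) (T : choiceType).

Lemma counting_le (A : set T) n : (A #<= `I_n)%card ->
  (counting A <= (n%:R : R)%:E)%E.
Proof.
move=> An; rewrite /counting asboolT; last by apply/finite_set_leP; exists n.
by rewrite lee_fin ler_nat; exact: geq_card_fset_set.
Qed.

Lemma counting_range (I : finType) (f : I -> T) : injective f ->
  counting (range f) = (#|I|%:R : R)%:E.
Proof.
move=> fI; have fin : finite_set [set: I] by exact: finite_finset.
rewrite /counting asboolT; last exact: finite_image.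
rewrite fset_set_image// card_imfset//=; congr (_%:R%:E).
rewrite cardE; apply/perm_size/uniq_perm.
- exact: fset_uniq.
- exact: enum_uniq.
- by move=> x; rewrite mem_enum in_fset_set//; apply/mem_set.
Qed.

End counting_cardinality.

(** * Separated sets, horseshoes, and a lower bound on the metric mean dimension *)

Section separation.
Context {R : realType} {X : metricType R}.
Implicit Types (phi : X -> X) (n : nat) (eps : R).

Lemma bowen_dist_gt phi n eps x y : 0 <= eps ->
  eps < bowen_dist phi n x y <->
  exists2 j, (j < n)%N & eps < mdist (iter j phi x) (iter j phi y).
Proof.
move=> eps0; split => [|[j jn] lt].
  rewrite /bowen_dist ltNge => /negP h; apply: contrapT => nex; apply: h.
  apply: bigmax_le => // i _; rewrite leNgt; apply/negP => lt.
  by apply: nex; exists i.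
apply: lt_le_trans lt _; rewrite /bowen_dist.
exact: (le_bigmax 0 (fun i : 'I_n => mdist (iter i phi x) (iter i phi y)) (Ordinal jn)).
Qed.

Lemma limn_esup_le (u : nat -> \bar R) (l : \bar R) :
  (\forall n \near \oo, (u n <= l)%E) -> (limn_esup u <= l)%E.
Proof.
move=> ul; rewrite /limn_esup limf_esupE.
apply: le_trans (ereal_inf_lbound _) _ => /=.
  by exists [set n | (u n <= l)%E].
by apply: ge_ereal_sup => _ [n + <-].
Qed.

Lemma limn_esup_ge (u : nat -> \bar R) (l : \bar R) :
  (\forall n \near \oo, (l <= u n)%E) -> (l <= limn_esup u)%E.
Proof.
move=> lu; rewrite /limn_esup limf_esupE; apply: le_ereal_inf_tmp => _ [V Voo <-].
have [n [Vn ln]] : V `&` [set n | (l <= u n)%E] !=set0.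
  by apply: (@filter_ex _ \oo); exact: filterI.
by apply: le_trans ln _; apply: ereal_sup_ubound; exists n.
Qed.

Section horseshoe.
(* The boxes [P j i] depend on the time [j]: no periodic orbit is assumed. *)
Variables (phi : X -> X) (N : nat) (eps : R) (P : nat -> 'I_N.+1 -> set X).
Hypothesis eps_ge0 : 0 <= eps.
Hypothesis P_neq0 : forall j i, P j i !=set0.
Hypothesis P_cover : forall j i i' y, P j.+1 i' y -> exists2 x, P j i x & phi x = y.
Hypothesis P_sep : forall j i i' x y, P j i x -> P j i' y -> i != i' ->
  eps < mdist x y.

(** The orbit is built backwards: a point following the shifted itinerary from time [j.+1] is pulled
    back into the first box by [P_cover]. *)
Lemma horseshoe_itinerary (w : nat -> 'I_N.+1) n j : exists x,
  forall m, (m <= n)%N -> P (j + m) (w m) (iter m phi x).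
Proof.
elim: n w j => [|n IH] w j.
  by have [x Px] := P_neq0 j (w 0%N); exists x => m; rewrite leqn0 => /eqP->; rewrite addn0.
have [y Py] := IH (w \o S) j.+1.
have := Py 0%N (leq0n _); rewrite addn0 => /P_cover-/(_ (w 0%N))[x Px xy].
exists x => -[|m]; first by rewrite addn0.
by rewrite ltnS => mn; rewrite iterSr xy addnS -addSn; exact: Py.
Qed.

Lemma horseshoe_sep_card n :
  (((N.+1 ^ n)%:R : R)%:E <= sep_card phi n eps)%E.
Proof.
(* A word of length [n] is padded with [ord0] to an infinite itinerary; each word then gets one
   point, and distinct words are separated at a time where they differ. *)
pose w (f : {ffun 'I_n -> 'I_N.+1}) m := oapp f ord0 (insub m).
have [pt ptP] : {pt : {ffun 'I_n -> 'I_N.+1} -> X & forall (f : {ffun 'I_n -> 'I_N.+1}) (j : 'I_n),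
    P j (f j) (iter j phi (pt f))}.
  apply: (@choice _ _ (fun (f : {ffun 'I_n -> 'I_N.+1}) x =>
    forall j : 'I_n, P j (f j) (iter j phi x))) => f.
  have [x Px] := horseshoe_itinerary (w f) n 0.
  exists x => j; have := Px j (ltnW (ltn_ord j)).
  by rewrite /w valK.
have sep (f f' : {ffun 'I_n -> 'I_N.+1}) : f != f' -> eps < bowen_dist phi n (pt f) (pt f').
  move=> ff'; apply/bowen_dist_gt => //.
  have [j fj] : exists j, f j != f' j.
    apply/existsP; apply: contraNT ff'; rewrite negb_exists => /forallP h.
    by apply/eqP/ffunP => j; apply/eqP; rewrite -[_ == _]negbK h.
  by exists j => //; exact: P_sep fj.
have pt_inj : injective pt.
  move=> f f' ff'; apply/eqP; apply: contraT => /sep; rewrite ff'.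
  case/(bowen_dist_gt _ _ _ _ eps_ge0) => j _.
  by rewrite mdistxx ltNge eps_ge0.
have -> : ((N.+1 ^ n)%:R : R)%:E = counting (range pt).
  by rewrite counting_range// card_ffun !card_ord.
apply: ereal_sup_ubound => /=; exists (range pt) => //.
move=> _ _ [f _ <-] [f' _ <-] ff'; apply: sep; apply/eqP => e.
by apply: ff'; rewrite e.
Qed.

Lemma horseshoe_sep_rate : ((ln N.+1%:R)%:E <= sep_rate phi eps)%E.
Proof.
apply: limn_esup_ge; exists 1%N => // n /= n0.
have h : ((n%:R * ln N.+1%:R : R)%:E <= lne (sep_card phi n eps))%E.
  have -> : n%:R * ln N.+1%:R = ln ((N.+1 ^ n)%:R) :> R.
    by rewrite natrX lnXn ?ltr0n// mulr_natl.
  rewrite -lne_EFin ?ltr0n ?expn_gt0// lee_lne ?horseshoe_sep_card//.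
    by rewrite in_itv/= lee_fin ler0n leey.
  by rewrite in_itv/= leey andbT (le_trans _ (horseshoe_sep_card n))// lee_fin ler0n.
have -> : (ln N.+1%:R : R)%:E = ((n%:R^-1)%:E * (n%:R * ln N.+1%:R)%:E)%E.
  by rewrite -EFinM mulKf// pnatr_eq0 -lt0n.
by apply: lee_wpmul2l => //; rewrite lee_fin invr_ge0 ler0n.
Qed.

End horseshoe.

(** For the largest [k] with [eps <= c / 4 ^+ k], [k * ln 2] is about half of [|ln eps|]; giving up
    another factor 2 absorbs [c] and the rounding of [k]. *)
Lemma lower_mdim_ge_quarter phi (c : R) : 0 < c <= 1 ->
  (forall k eps, 0 < eps -> eps <= c / 4 ^+ k ->
     ((k%:R * ln 2)%:E <= sep_rate phi eps)%E) ->
  ((4^-1 : R)%:E <= lower_mdim phi)%E.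
Proof.
move=> /andP[c0 c1] rate; rewrite /lower_mdim limf_einfE.
have ln2 : 0 < ln 2 :> R by rewrite ln_gt0// ltr1n.
have lnc : ln c <= 0 by rewrite ln_le0// c1.
(* From [k * ln 2 > (ln c - ln eps) / 2 - ln 2], the bound [- ln eps / 4] follows as soon as
   [ln eps <= 2 * ln c - 4 * ln 2]. *)
pose d : R := expR (2 * ln c - 4 * ln 2).
have d0 : 0 < d by rewrite expR_gt0.
apply: (@le_trans _ _ (ereal_inf [set (sep_rate phi eps * (`|ln eps|^-1)%:E)%E
    | eps in [set eps | 0 < eps < d]])); last first.
  apply: ereal_sup_ubound; exists [set eps | 0 < eps < d] => //.
  near=> e; rewrite /=; apply/andP; split; near: e.
    exact: nbhs_right_gt.
  exact: nbhs_right_lt.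
apply: le_ereal_inf_tmp => _ [eps /= /andP[eps0 epsd] <-].
have epsc : ln eps < 2 * ln c - 4 * ln 2.
  by rewrite -[X in _ < X]expRK ltr_ln// posrE expR_gt0.
have lneps : ln eps < 0 by move: epsc lnc ln2; clear; lra.
pose k := Num.trunc ((ln c - ln eps) / (2 * ln 2)).
have /andP[] : k%:R <= (ln c - ln eps) / (2 * ln 2) < k.+1%:R.
  apply: truncn_itv; rewrite divr_ge0//; move: epsc lnc ln2; clear; lra.
have ln22 : 0 < 2 * ln 2 :> R by rewrite mulr_gt0.
rewrite ler_pdivlMr// ltr_pdivrMr// -natr1 => k1 k2.
have epsk : eps <= c / 4 ^+ k.
  rewrite -ler_ln ?posrE ?divr_gt0 ?exprn_gt0//.
  rewrite ln_div ?posrE ?exprn_gt0// lnXn// -[ln _ *+ _]mulr_natl.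
  have -> : 4 = 2 ^+ 2 :> R by rewrite -natrX.
  by rewrite lnXn// -[ln _ *+ _]mulr_natl; move: k1; clear; lra.
apply: (@le_trans _ _ ((k%:R * ln 2)%:E * (`|ln eps|^-1)%:E)%E); last first.
  by apply: lee_wpmul2r (rate _ _ eps0 epsk); rewrite lee_fin invr_ge0.
rewrite -EFinM lee_fin ltr0_norm// ler_pdivlMr ?oppr_gt0//.
by move: k1 k2 epsc lnc ln2; clear; lra.
Unshelve. all: by end_near. Qed.

End separation.

(** * Lipschitz maps have upper metric mean dimension at most 0 *)

Section lipschitz.
Variable R : realType.
Local Notation pi := (\pi_(circle R)).

(** Pigeonhole: cut [[0, 1)] into [m.+1] half-open cells of equal length; two points in one cell are
    closer than [m.+1%:R^-1]. *)
Lemma circle_packing (A : set (circle R)) (m : nat) :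
  (forall p q, A p -> A q -> p <> q -> m.+1%:R^-1 <= mdist p q) ->
  (counting A <= (m.+1%:R : R)%:E)%E.
Proof.
move=> sep; apply: counting_le.
have /choice[x xP] (p : circle R) : exists x : R, 0 <= x < 1 /\ pi x = p.
  by have [x] := circle_pi_01 p; exists x.
pose f p := Num.trunc (m.+1%:R * x p).
have m0 : 0 < m.+1%:R :> R by rewrite ltr0n.
have fle p : (f p)%:R <= m.+1%:R * x p < (f p).+1%:R.
  by apply: truncn_itv; have [/andP[x0 _] _] := xP p; rewrite mulr_ge0.
have finj : {in A &, injective f}.
  move=> p q /set_mem Ap /set_mem Aq fpq; apply: contrapT => /(sep _ _ Ap Aq).
  have [_ {1}<-] := xP p; have [_ {1}<-] := xP q.
  apply/negP; rewrite -ltNge; apply: le_lt_trans (circle_mdist_pi _ _) _.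
  rewrite -[X in _ < X]mulr1 -ltr_pdivrMl ?invr_gt0// invrK.
  rewrite -[X in X * _](ger0_norm (ltW m0)) -normrM mulrBr ltr_norml.
  have := fle p; have := fle q; rewrite fpq -natr1.
  by move=> /andP[? ?] /andP[? ?]; lra.
rewrite -(card_le_eql (inj_card_eq finj)); apply: subset_card_le => _ [p _ <-] /=.
have [/andP[_ x1] _] := xP p; have /andP[h _] := fle p.
by rewrite -(ltr_nat R); apply: le_lt_trans h _; rewrite gtr_pMr.
Qed.

Section upper_bound.
Variables (f : circle R -> circle R) (L : R).
Hypothesis L1 : 1 <= L.
Hypothesis fL : forall p q, mdist (f p) (f q) <= L * mdist p q.

Lemma lipschitz_iter n p q : mdist (iter n f p) (iter n f q) <= L ^+ n * mdist p q.
Proof.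
elim: n => [|n IH] /=; first by rewrite expr0 mul1r.
apply: le_trans (fL _ _) _; rewrite exprS -mulrA ler_wpM2l//.
exact: le_trans L1.
Qed.

(** Separated points are at least [eps / L ^+ n] apart by [lipschitz_iter], so packing applies. The
    factor 2 covers the rounding up, since [L ^+ n / eps >= 1]. *)
Lemma lipschitz_sep_card n (eps : R) : 0 < eps <= 1 ->
  (sep_card f n eps <= (2 * L ^+ n / eps)%:E)%E.
Proof.
move=> /andP[eps0 eps1]; apply: ge_ereal_sup => _ [A /= sepA <-].
have Ln1 : 1 <= L ^+ n by exact: exprn_ege1.
have Ln0 : 0 < L ^+ n by exact: lt_le_trans Ln1.
pose m := Num.trunc (L ^+ n / eps).
have /andP[m1 m2] : m%:R <= L ^+ n / eps < m.+1%:R.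
  by apply: truncn_itv; rewrite divr_ge0// ltW.
apply: (@le_trans _ _ (m.+1%:R%:E)); last first.
  rewrite lee_fin -natr1 -mulrA [X in _ <= X]mulr_natl mulr2n lerD//.
  by rewrite ler_pdivlMr// mul1r (le_trans eps1).
apply: circle_packing => p q Ap Aq pq.
have [j jn epsj] := (bowen_dist_gt _ _ _ _ (ltW eps0)).1 (sepA _ _ Ap Aq pq).
apply: (@le_trans _ _ (eps / L ^+ n)).
  by rewrite -[eps / _]invrK invf_div lef_pV2 ?posrE ?ltr0n ?divr_gt0// ltW.
rewrite ler_pdivrMr// mulrC; apply: le_trans (ltW epsj) _.
apply: le_trans (lipschitz_iter _ _ _) _.
by rewrite ler_wpM2r// ?mdist_ge0// ler_weXn2l// ltnW.
Qed.

Lemma sep_card_ge0 n (eps : R) : (0 <= sep_card f n eps)%E.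
Proof.
apply: le_trans (ereal_sup_ubound _); last by exists set0 => //= ? ? [].
by rewrite /counting; case: ifP => _; rewrite ?leey// lee_fin ler0n.
Qed.

(** The term [ln (2 / eps) / n] is at most 1 for large [n]. What matters is that the resulting bound
    does not depend on [eps], so dividing by [|ln eps|] sends it to 0. *)
Lemma lipschitz_sep_rate (eps : R) : 0 < eps <= 1 ->
  (sep_rate f eps <= (ln L + 1)%:E)%E.
Proof.
move=> eps01; have /andP[eps0 eps1] := eps01.
apply: limn_esup_le; pose K := Num.trunc (ln (2 / eps)).
exists K.+1 => // n /= Kn.
have n0 : 0 < n%:R :> R by rewrite ltr0n (leq_trans _ Kn).
have L0 : 0 < L by exact: lt_le_trans L1.
have lnK : ln (2 / eps) <= n%:R.
  by apply: (le_trans (ltW (truncnS_gt _))); rewrite ler_nat.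
have card0 : 0 < 2 * L ^+ n / eps by rewrite divr_gt0 ?mulr_gt0 ?exprn_gt0.
have h : (lne (sep_card f n eps) <= (n%:R * (ln L + 1))%:E)%E.
  apply: (@le_trans _ _ (lne (2 * L ^+ n / eps)%:E)).
    rewrite lee_lne ?lipschitz_sep_card// in_itv/= leey andbT ?sep_card_ge0//.
    by rewrite lee_fin ltW.
  rewrite lne_EFin// lee_fin mulrAC lnM ?posrE ?divr_gt0 ?exprn_gt0// lnXn//.
  by rewrite -[ln _ *+ _]mulr_natl mulrDr mulr1 addrC lerD2l.
apply: (@le_trans _ _ ((n%:R^-1)%:E * (n%:R * (ln L + 1))%:E)%E).
  by apply: lee_wpmul2l => //; rewrite lee_fin invr_ge0 ltW.
by rewrite -EFinM mulKf// gt_eqF.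
Qed.

Lemma lipschitz_upper_mdim : (upper_mdim f <= 0)%E.
Proof.
apply/lee_addgt0Pr => e e0; rewrite add0e /upper_mdim limf_esupE.
have lnL : 0 <= ln L by rewrite ln_ge0.
pose d : R := expR (- ((ln L + 1) / e)).
have d0 : 0 < d by rewrite expR_gt0.
apply: le_trans (ereal_inf_lbound _) _ => /=.
  exists [set eps | 0 < eps < d]; last by [].
  near=> r; rewrite /=; apply/andP; split; near: r.
    exact: nbhs_right_gt.
  exact: nbhs_right_lt.
apply: ge_ereal_sup => _ [eps /= /andP[eps0 epsd] <-].
have lne : (ln L + 1) / e < - ln eps.
  by rewrite ltrNr -[X in _ < X]expRK ltr_ln// posrE expR_gt0.
have lneps : 0 < - ln eps by apply: lt_trans lne; rewrite divr_gt0// ltr_wpDl.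
have eps1 : eps <= 1 by rewrite leNgt; apply/negP => /ln_gt0; lra.
apply: (@le_trans _ _ ((ln L + 1)%:E * (`|ln eps|^-1)%:E)%E).
  apply: lee_wpmul2r; first by rewrite lee_fin invr_ge0.
  by apply: lipschitz_sep_rate; rewrite eps0.
rewrite -EFinM lee_fin -normrN gtr0_norm// ler_pdivrMr//.
by move: lne; rewrite ltr_pdivrMr// mulrC => /ltW.
Unshelve. all: by end_near. Qed.

End upper_bound.
End lipschitz.

(** * The multiscale sawtooth and the horseshoes it creates *)

Section sawtooth.
Variable R : realType.
Local Notation pi := (\pi_(circle R)).
Implicit Types (t s e : R) (k : nat).

(** The triangle wave of period 1: the distance from [t] to the nearest integer. *)
Definition int_dist t : R := mdist (pi t) 0.

Lemma int_dist_ge0 t : 0 <= int_dist t.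
Proof. exact: mdist_ge0. Qed.

Lemma int_dist_le1 t : int_dist t <= 1.
Proof. exact: circle_dist_le1. Qed.

Lemma int_dist_lip t s : `|int_dist t - int_dist s| <= `|t - s|.
Proof. exact: le_trans (circle_mdist0_lip _ _) (circle_mdist_pi _ _). Qed.

Lemma int_dist_natD (n : nat) t : 0 <= t <= 2^-1 -> int_dist (n%:R + t) = t.
Proof.
move=> /andP[t0 t1].
rewrite /int_dist circle_piD (circle_pi_int (natr_int _ _)) add0r -circle_pi0.
by rewrite circle_mdist_pi_small subr0 ger0_norm.
Qed.

Lemma int_dist_nat (n : nat) : int_dist n%:R = 0.
Proof. by rewrite -[n%:R]addr0 int_dist_natD// lexx invr_ge0/=. Qed.

Definition saw_teeth k : R := 2 ^+ k.+2.
Definition saw_freq k : R := 2 ^+ k.+3.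
Local Notation h := saw_teeth.
Local Notation q := saw_freq.

Let qE k : q k = 2 * h k.
Proof. by rewrite /saw_freq exprS. Qed.

Let h4 k : 4 <= h k.
Proof.
rewrite /saw_teeth !exprS mulrA -natrM -[X in X <= _]mulr1 ler_wpM2l//.
by rewrite exprn_ege1// ler1n.
Qed.

Definition clamp (a b t : R) : R := Num.max a (Num.min b t).

Lemma clamp_lip a b t s : `|clamp a b t - clamp a b s| <= `|t - s|.
Proof.
rewrite /clamp; case: (leP b t) => ?; case: (leP b s) => ?;
  case: (leP a b) => ?; case: (leP a t) => ?; case: (leP a s) => ?;
  rewrite ler_norml; case: (ger0P (t - s)) => ?; lra.
Qed.

(* [2 ^+ k.+2] teeth on the interval [`[2 ^- k.+4, 2 ^- k.+3]], all higher than
   its right end, and [0] elsewhere. *)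
Definition saw k t : R :=
  2 / q k * int_dist (clamp (2 * q k)^-1 (q k)^-1 t * q k ^+ 2).

Let q0 k : 0 < q k.
Proof. exact: exprn_gt0. Qed.

Let q20 k : 0 < 2 * q k.
Proof. by rewrite mulr_gt0. Qed.

#[local] Hint Resolve q0 q20 : core.

Lemma saw_ge0 k t : 0 <= saw k t.
Proof. by rewrite mulr_ge0 ?int_dist_ge0// divr_ge0// ltW. Qed.

Lemma saw_leq k t : saw k t <= 2 / q k.
Proof. by rewrite -[X in _ <= X]mulr1 ler_wpM2l ?int_dist_le1// divr_ge0// ltW. Qed.

Lemma saw_le k t : saw k t <= 4^-1.
Proof.
apply: le_trans (saw_leq _ _) _.
by rewrite ler_pdivrMr// qE; have := h4 k; lra.
Qed.

Lemma saw_lip k t s : `|saw k t - saw k s| <= 2 * q k * `|t - s|.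
Proof.
rewrite -mulrBr normrM ger0_norm; last by rewrite divr_ge0// ltW.
apply: (@le_trans _ _ (2 / q k * (`|t - s| * q k ^+ 2))).
  rewrite ler_wpM2l//; first by rewrite divr_ge0// ltW.
  apply: le_trans (int_dist_lip _ _) _.
  rewrite -mulrBl normrM (ger0_norm (exprn_ge0 2 (ltW (q0 k)))).
  by rewrite ler_wpM2r ?clamp_lip// exprn_ge0// ltW.
by rewrite le_eqVlt; apply/orP; left; apply/eqP; field; rewrite gt_eqF.
Qed.

(** Clamping freezes [t] at an end of the interval, where its product with [q k ^+ 2] is an integer;
    the same happens at the right end. *)
Lemma saw_eq0_le k t : t <= (2 * q k)^-1 -> saw k t = 0.
Proof.
move=> tq; rewrite /saw /clamp.
have le : (2 * q k)^-1 <= (q k)^-1.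
  by rewrite lef_pV2 ?posrE//; have := q0 k; lra.
rewrite max_l; last by rewrite ge_min tq orbT.
have -> : (2 * q k)^-1 * q k ^+ 2 = (2 ^ k.+2)%:R.
  by rewrite natrX -/(h k) qE; field; rewrite gt_eqF//; have := h4 k; lra.
by rewrite int_dist_nat mulr0.
Qed.

Lemma saw_eq0_ge k t : (q k)^-1 <= t -> saw k t = 0.
Proof.
move=> tq; rewrite /saw /clamp.
have le : (2 * q k)^-1 <= (q k)^-1.
  by rewrite lef_pV2 ?posrE//; have := q0 k; lra.
rewrite min_l// max_r//.
have -> : (q k)^-1 * q k ^+ 2 = (2 ^ k.+3)%:R.
  by rewrite natrX -/(q k); field; rewrite gt_eqF.
by rewrite int_dist_nat mulr0.
Qed.

(** The map [w] of the construction. At most one saw is nonzero at each point, so the supremum glues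
    all scales together. *)
Definition sawsup t : R := sup (range (saw ^~ t)).

Let saw_ub t : has_ubound (range (saw ^~ t)).
Proof. by exists 4^-1 => _ [k _ <-]; exact: saw_le. Qed.

Lemma sawsup_ge k t : saw k t <= sawsup t.
Proof. by apply: ub_le_sup => //; exists k. Qed.

Lemma sawsup_le t e : (forall k, saw k t <= e) -> sawsup t <= e.
Proof. by move=> te; apply: ge_sup => [|_ [k _ <-]//]; exists (saw 0 t), 0%N. Qed.

Lemma sawsup_itv t : 0 <= sawsup t <= 4^-1.
Proof.
by rewrite (le_trans (saw_ge0 0 t) (sawsup_ge _ _))/= sawsup_le// => k; exact: saw_le.
Qed.

(** A modulus of continuity common to all scales: saws with [2 / q k <= e] stay below [e]
    altogether, and the others have slope [2 * q k < 4 / e]. *)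
Lemma sawsup_hoelder t s e : 0 < e -> `|t - s| <= e ^+ 2 / 4 ->
  `|sawsup t - sawsup s| <= e.
Proof.
move=> e0; wlog suff le : t s / `|t - s| <= e ^+ 2 / 4 -> sawsup t <= sawsup s + e.
  move=> ts; have := le _ _ ts; have := le s t; rewrite distrC => /(_ ts).
  by rewrite ler_norml; lra.
move=> ts; apply: sawsup_le => k; have := sawsup_ge k s; have := saw_ge0 k s.
have := saw_leq k t; have := saw_lip k t s; have [|qe] := leP (2 / q k) e; first lra.
have : 2 * q k * `|t - s| <= e.
  apply: (@le_trans _ _ (2 * q k * (e ^+ 2 / 4))).
    by rewrite ler_wpM2l// mulr_ge0// ltW.
  have -> : 2 * q k * (e ^+ 2 / 4) = e * ((e * q k) / 2) by field.
  rewrite -[X in _ <= X]mulr1 ler_wpM2l ?(ltW e0)//.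
  by move: qe; rewrite ltr_pdivlMr//; lra.
by rewrite !ler_norml => ? /andP[? ?]; lra.
Qed.

Lemma sawsupE k t : (2 * q k)^-1 <= t <= (q k)^-1 -> sawsup t = saw k t.
Proof.
move=> /andP[t1 t2]; apply/le_anti; rewrite sawsup_ge andbT.
apply: sawsup_le => l; have [lk|kl|->//] := ltngtP l k.
  rewrite saw_eq0_le ?saw_ge0//; apply: le_trans t2 _.
  rewrite lef_pV2 ?posrE// /saw_freq -exprS ler_weXn2l ?ler1n//.
rewrite saw_eq0_ge ?saw_ge0//; apply: le_trans t1.
by rewrite lef_pV2 ?posrE// /saw_freq -exprS ler_weXn2l ?ler1n.
Qed.

(** The upper half of the rising flank of tooth [i]. There [saw k] equals [2 * r / q k], which runs
    over exactly [[(2 * q k)^-1, (q k)^-1]]. *)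
Definition tooth k (i : nat) : set R :=
  [set t | exists2 r, 4^-1 <= r <= 2^-1 & t = (h k + i%:R + r) / q k ^+ 2].

Lemma tooth_itv k i t : (i < 2 ^ k.+2)%N -> tooth k i t ->
  (2 * q k)^-1 <= t <= (q k)^-1.
Proof.
rewrite -(ltr_nat R) natrX -/(h k) => ih [r /andP[r1 r2] ->].
have i1 : i%:R + 1 <= h k by rewrite natr1 /saw_teeth -natrX ler_nat -(ltr_nat R) natrX.
have qq0 : 0 < q k ^+ 2 by rewrite exprn_gt0.
have -> : (2 * q k)^-1 = h k / q k ^+ 2.
  by rewrite qE; field; rewrite gt_eqF//; have := h4 k; lra.
have -> : (q k)^-1 = (2 * h k) / q k ^+ 2.
  by rewrite qE; field; rewrite gt_eqF//; have := h4 k; lra.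
rewrite !ler_pM2r ?invr_gt0//.
by have : 0 <= i%:R :> R by []; lra.
Qed.

Lemma tooth_onto k i y : (i < 2 ^ k.+2)%N -> (2 * q k)^-1 <= y <= (q k)^-1 ->
  exists2 t, tooth k i t & sawsup t = y.
Proof.
move=> ih /andP[y1 y2].
have r1 : 4^-1 <= y * q k / 2.
  by move: y1; rewrite -[X in X <= _]mul1r ler_pdivrMr//; lra.
have r2 : y * q k / 2 <= 2^-1.
  by move: y2; rewrite -[X in _ <= X]mul1r ler_pdivlMr//; lra.
have tt : tooth k i ((h k + i%:R + y * q k / 2) / q k ^+ 2).
  by exists (y * q k / 2); rewrite ?r1.
exists ((h k + i%:R + y * q k / 2) / q k ^+ 2) => //.
have /andP[t1 t2] := tooth_itv ih tt.
rewrite (@sawsupE k) ?t1// /saw /clamp min_r// max_r//.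
rewrite divfK; last by rewrite gt_eqF ?exprn_gt0.
rewrite /saw_teeth -natrX -natrD int_dist_natD; first by field; rewrite gt_eqF.
by rewrite r2 andbT; move: r1; lra.
Qed.

(** In units of [q k ^- 2], the indices differ by at least 1 and the offsets [r] by at most 1/4,
    which leaves a gap of at least 3/4. *)
Lemma tooth_sep k i j t s : tooth k i t -> tooth k j s -> i != j ->
  (2 * q k ^+ 2)^-1 < `|t - s|.
Proof.
move=> [r /andP[r1 r2] ->] [r' /andP[r'1 r'2] ->] ij.
have qq0 : 0 < q k ^+ 2 by rewrite exprn_gt0.
rewrite -mulrBl normrM (@ger0_norm _ (_ ^-1)); last by rewrite invr_ge0 ltW.
rewrite invfM ltr_pM2r ?invr_gt0//.
have : (1 : R) <= `|i%:R - j%:R|.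
  rewrite norm_intr_ge1 ?rpredB ?natr_int// subr_eq0 eqr_nat//.
have := ler_normD (h k + i%:R + r - (h k + j%:R + r')) (r' - r).
have -> : h k + i%:R + r - (h k + j%:R + r') + (r' - r) = i%:R - j%:R by ring.
have : `|r' - r| <= 4^-1 by rewrite ler_norml; lra.
by lra.
Qed.

(** The teeth of scale [k], shrunk by [m] and moved to [u j], are the boxes at time [j]. The image
    of each contains every box at time [j.+1], wherever the base orbit [u] goes. *)
Lemma saw_orbit_lower_mdim (psi : circle R -> circle R) (m : R)
    (u : nat -> circle R) : 1 <= m ->
  (forall j t, 0 <= t <= 4^-1 ->
     psi (u j + pi (t / m)) = u j.+1 + pi (sawsup t / m)) ->
  ((4^-1 : R)%:E <= lower_mdim psi)%E.
Proof.
move=> m1 psiE.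
have m0 : 0 < m by exact: lt_le_trans m1.
(* As [2 * q k ^+ 2 = 128 * 4 ^+ k], this constant makes [c / 4 ^+ k] the separation of the shrunken
   teeth. *)
apply: (@lower_mdim_ge_quarter _ _ _ (128 * m)^-1).
  rewrite invr_gt0 mulr_gt0// invf_le1; first by lra.
  by rewrite mulr_gt0.
move=> k eps eps0 epsc.
have qm : eps <= (2 * q k ^+ 2)^-1 / m.
  apply: le_trans epsc _; rewrite le_eqVlt; apply/orP; left; apply/eqP.
  rewrite /saw_freq !exprS exprMn.
  have -> : 4 ^+ k = (2 ^+ k) ^+ 2 :> R.
    by rewrite exprAC; congr (_ ^+ _); rewrite -natrX.
  by field; rewrite !gt_eqF//= exprn_gt0.
have N0 : (0 < 2 ^ k.+2)%N by rewrite expn_gt0.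
pose P j (i : 'I_(2 ^ k.+2).-1.+1) : set (circle R) :=
  [set u j + pi (t / m) | t in tooth k i].
have ltN (i : 'I_(2 ^ k.+2).-1.+1) : (i < 2 ^ k.+2)%N.
  by rewrite -[X in (_ < X)%N](prednK N0).
have itv i t : tooth k (i : 'I_(2 ^ k.+2).-1.+1) t -> 0 <= t <= 4^-1.
  move=> /(tooth_itv (ltN _))/andP[t1 t2]; apply/andP; split.
    by apply: le_trans t1; rewrite invr_ge0 ltW.
  by apply: le_trans t2 _; rewrite lef_pV2 ?posrE// qE; have := h4 k; lra.
apply: le_trans (@horseshoe_sep_rate _ _ psi (2 ^ k.+2).-1 eps P _ _ _ _).
- rewrite (prednK N0) natrX lnXn// -[ln _ *+ _]mulr_natl lee_fin ler_wpM2r//.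
    by rewrite ln_ge0// ler1n.
  by rewrite ler_nat -addn2 leq_addr.
- exact: ltW.
- move=> j i.
  exists (u j + pi ((h k + i%:R + 2^-1) / q k ^+ 2 / m)).
  by exists ((h k + i%:R + 2^-1) / q k ^+ 2) => //; exists 2^-1 => //; lra.
- move=> j i i' _ [t ti <-].
  have [s si st] := tooth_onto (ltN i) (tooth_itv (ltN i') ti).
  exists (u j + pi (s / m)); first by exists s.
  by rewrite psiE ?st// (itv _ _ si).
- move=> j i i' _ _ [t ti <-] [s si <-] ii'.
  apply: le_lt_trans qm _; rewrite circle_mdistDl circle_mdist_pi_small.
    rewrite -mulrBl normrM (@ger0_norm _ m^-1) ?invr_ge0 ?(ltW m0)//.
    by rewrite ltr_pM2r ?invr_gt0//; exact: tooth_sep ti si ii'.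
  rewrite -mulrBl normrM (@ger0_norm _ m^-1) ?invr_ge0 ?(ltW m0)//.
  rewrite ler_pdivrMr//; have := itv _ _ ti; have := itv _ _ si.
  have : `|t - s| <= 4^-1 -> `|t - s| <= 2^-1 * m by lra.
  by move=> + /andP[? ?] /andP[? ?]; apply; rewrite ler_norml; lra.
Qed.

End sawtooth.

(** * The Lipschitz step map on a grid and its perturbation by the sawtooth *)

Section step_map.
Variable R : realType.
Local Notation pi := (\pi_(circle R)).
Implicit Types (x y t : R) (k : int) (p q u : circle R).

Lemma continuous_circle_map (f : circle R -> circle R) :
  (forall e : R, 0 < e -> exists2 d, 0 < d &
     forall p q, mdist p q < d -> mdist (f p) (f q) < e) -> continuous f.
Proof.
move=> fc p U /nbhs_ballP[e /= e0 eU]; have [d d0 fd] := fc e e0.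
apply/nbhs_ballP; exists d => //= q; rewrite ballEmdist /= => pq.
by apply: eU; rewrite ballEmdist; exact: fd.
Qed.

Definition ramp t : R := Num.max 0 (2 * t - 1).

Lemma ramp_lip t t' : `|ramp t - ramp t'| <= 2 * `|t - t'|.
Proof.
rewrite /ramp; case: (leP 0 (2 * t - 1)) => ?; case: (leP 0 (2 * t' - 1)) => ?;
  rewrite ler_norml; case: (ger0P (t - t')) => ?; lra.
Qed.

Lemma ramp_itv t : 0 <= t <= 1 -> 0 <= ramp t <= 1.
Proof. by rewrite /ramp; case: (leP 0 (2 * t - 1)) => ? /andP[? ?]; lra. Qed.

Lemma ramp_eq0 t : t <= 2^-1 -> ramp t = 0.
Proof. by rewrite /ramp; case: (leP 0 (2 * t - 1)) => ? ?; lra. Qed.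

Lemma ramp1 : ramp 1 = 1.
Proof. by rewrite /ramp; case: (leP 0 (2 * 1 - 1)) => ?; lra. Qed.

(** [s u] is a signed real lift of the increment of [A] from [u] to the point [m^-1] further; it
    selects the arc along which the step map moves. *)
Variables (M : nat) (A : circle R -> circle R) (s : circle R -> R).
Local Notation m := (M.+1%:R : R).
Hypothesis sA : forall u, pi (s u) = A (u + pi m^-1) - A u.
Hypothesis s1 : forall u, `|s u| <= 1.

Definition grid k : circle R := pi (k%:~R / m).

(* Constant on the first half of the cell [`[k / m, (k + 1) / m]], then linear
   up to the next grid point. *)
Definition step_lift x : circle R :=
  let k := Num.floor (m * x) in
  A (grid k) + pi (ramp (m * x - k%:~R) * s (grid k)).

Definition step_map p : circle R := step_lift (repr p).

Let m0 : 0 < m. Proof. by rewrite ltr0n. Qed.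
Let mN0 : m != 0. Proof. by rewrite pnatr_eq0. Qed.
#[local] Hint Resolve m0 mN0 : core.

Lemma gridS k : A (grid (k + 1)) = A (grid k) + pi (s (grid k)).
Proof.
rewrite sA [RHS]addrC subrK /grid -circle_piD; congr (A (pi _)).
by rewrite intrD mulrDl mul1r.
Qed.

(** At the right end the floor is already [k + 1]; both formulas agree there because the ramp
    reaches 1 and [s] lifts the increment of [A]. *)
Lemma step_lift_cell k x : k%:~R <= m * x <= k%:~R + 1 ->
  step_lift x = A (grid k) + pi (ramp (m * x - k%:~R) * s (grid k)).
Proof.
move=> /andP[kx]; rewrite le_eqVlt => /orP[/eqP xk|xk].
  have fl : Num.floor (m * x) = k + 1 by rewrite xk -(intrD _ _ 1) intrKfloor.
  rewrite /step_lift fl intrD xk subrr addrAC subrr add0r ramp1 mul1r.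
  by rewrite ramp_eq0 ?invr_ge0// mul0r circle_pi0 addr0 gridS.
have fl : Num.floor (m * x) = k by apply: floor_def; rewrite kx intrD.
by rewrite /step_lift fl.
Qed.

Lemma step_lift_periodic x y : x - y \is a Num.int -> step_lift x = step_lift y.
Proof.
move=> /intrP[z /eqP]; rewrite subr_eq => /eqP ->.
pose k := Num.floor (m * y).
have mz : m * (z%:~R + y) = (M.+1%:Z * z)%:~R + m * y by rewrite mulrDr intrM.
have gz : grid (M.+1%:Z * z + k) = grid k.
  rewrite /grid intrD mulrDl circle_piD intrM mulrAC divff// mul1r.
  by rewrite circle_pi_int ?intr_int// add0r.
have /andP[k1 k2] : k%:~R <= m * y < (k + 1)%:~R by exact: floor_itv.
rewrite (@step_lift_cell (M.+1%:Z * z + k)) ?gz; last first.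
  by rewrite mz intrD; move: k2; rewrite intrD; lra.
rewrite (@step_lift_cell k y); last by move: k2; rewrite intrD; lra.
by rewrite mz intrD opprD addrACA subrr add0r.
Qed.

Lemma step_mapE x : step_map (pi x) = step_lift x.
Proof. by apply: step_lift_periodic; apply/circle_piP; rewrite reprK. Qed.

Let cell_lip k x y : k%:~R <= m * x <= k%:~R + 1 -> k%:~R <= m * y <= k%:~R + 1 ->
  mdist (step_lift x) (step_lift y) <= 2 * m * `|x - y|.
Proof.
move=> /step_lift_cell-> /step_lift_cell->; rewrite circle_mdistDl.
apply: le_trans (circle_mdist_pi _ _) _; rewrite -mulrBl normrM.
apply: (@le_trans _ _ (2 * `|m * x - k%:~R - (m * y - k%:~R)| * 1)).
  by rewrite ler_pM// ramp_lip.
by rewrite mulr1 opprB addrA subrK -mulrBr normrM (ger0_norm (ltW m0)) mulrA.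
Qed.

(** Within a cell the ramp has slope 2 and [s] is bounded by 1. Adjacent cells are joined through
    their common grid point [z]. Otherwise [m * |x - y| > 1], and distances on the circle are at
    most 1. *)
Lemma step_lift_lip x y : mdist (step_lift x) (step_lift y) <= 2 * m * `|x - y|.
Proof.
wlog xy : x y / x <= y.
  have [xy|/ltW yx] := leP x y; first exact.
  by rewrite metric_sym distrC; exact.
pose k := Num.floor (m * x).
have /andP[k1] : k%:~R <= m * x < (k + 1)%:~R by exact: floor_itv.
rewrite intrD => k2.
have mxy : m * x <= m * y by rewrite ler_pM2l.
have [yk|ky] := leP (m * y) (k%:~R + 1); first by apply: (@cell_lip k); lra.
rewrite distrC (ger0_norm (_ : 0 <= y - x)) ?subr_ge0//.
have [y2|y2] := leP (m * y) (k%:~R + 1 + 1); last first.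
  apply: le_trans (circle_dist_le1 _ _) _.
  by rewrite -mulrA mulrBr; lra.
pose z := (k%:~R + 1) / m.
have mz : m * z = k%:~R + 1 by rewrite mulrC divfK.
apply: le_trans (metric_triangle _ (step_lift z) _) _.
have xz : x <= z by rewrite -(ler_pM2l m0) mz; lra.
have zy : z <= y by rewrite -(ler_pM2l m0) mz; lra.
have h1 : mdist (step_lift x) (step_lift z) <= 2 * m * (z - x).
  rewrite -[z - x]ger0_norm ?subr_ge0// distrC.
  by apply: (@cell_lip k); rewrite ?mz; lra.
have h2 : mdist (step_lift z) (step_lift y) <= 2 * m * (y - z).
  rewrite -[y - z]ger0_norm ?subr_ge0// distrC.
  by apply: (@cell_lip (k + 1)); rewrite intrD ?mz; lra.
apply: le_trans (lerD h1 h2) _.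
by rewrite -mulrDr addrC subrKA.
Qed.

Lemma step_map_lip p q : mdist (step_map p) (step_map q) <= 2 * m * mdist p q.
Proof.
have m20 : 0 < 2 * m by rewrite mulr_gt0.
rewrite leNgt; apply/negP; rewrite -ltr_pdivlMl// => /circle_mdist_lt.
move=> [x [y [<- <-]]]; rewrite !step_mapE ltr_pdivlMl//.
by rewrite ltNge step_lift_lip.
Qed.

Lemma step_map_continuous : continuous step_map.
Proof.
apply: continuous_circle_map => e e0; exists (e / (2 * m)).
  by rewrite divr_gt0// mulr_gt0.
move=> p q pq; apply: le_lt_trans (step_map_lip _ _) _.
by rewrite -ltr_pdivlMl ?mulr_gt0// [X in _ < X]mulrC.
Qed.

Lemma step_map_upper_mdim : (upper_mdim step_map <= 0)%E.
Proof.
apply: (@lipschitz_upper_mdim _ _ (2 * m)) step_map_lip.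
have : 1 <= m by rewrite ler1n.
by lra.
Qed.

(** Passing through the left grid point of the cell costs [c] for moving [phi] there, [a] for
    replacing [phi] by [A], and [b] for the ramp. *)
Lemma step_map_near (phi : circle R -> circle R) (a b c : R) :
  (forall u, mdist (phi u) (A u) <= a) -> (forall u, `|s u| <= b) ->
  (forall p q, mdist p q <= m^-1 -> mdist (phi p) (phi q) <= c) ->
  forall p, mdist (phi p) (step_map p) <= a + b + c.
Proof.
move=> phiA sb phic p; rewrite -[p]reprK step_mapE; set x := repr p.
pose k := Num.floor (m * x).
have /andP[k1] : k%:~R <= m * x < (k + 1)%:~R by exact: floor_itv.
rewrite intrD => k2.
rewrite (@step_lift_cell k); last by lra.
have phixk : mdist (phi (pi x)) (phi (grid k)) <= c.
  apply: phic; apply: le_trans (circle_mdist_pi _ _) _.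
  rewrite -(ler_pM2l m0) divff// -[X in X * _](ger0_norm (ltW m0)) -normrM.
  by rewrite mulrBr mulrCA divff// mulr1 ler_norml; lra.
have As : mdist (A (grid k)) (A (grid k) + pi (ramp (m * x - k%:~R) * s (grid k))) <= b.
  rewrite -{1}[A _]addr0 circle_mdistDl -circle_pi0.
  apply: le_trans (circle_mdist_pi _ _) _; rewrite sub0r normrN normrM.
  have /ramp_itv/andP[r0 r1] : 0 <= m * x - k%:~R <= 1 by lra.
  by rewrite ger0_norm// (le_trans _ (sb (grid k)))// ler_piMl.
have := metric_triangle (phi (pi x)) (phi (grid k)) (A (grid k) + pi (ramp (m * x - k%:~R) * s (grid k))).
have := metric_triangle (phi (grid k)) (A (grid k)) (A (grid k) + pi (ramp (m * x - k%:~R) * s (grid k))).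
have := phiA (grid k).
by move: phixk As; clear; lra.
Qed.

(** Multiplication by [M.+1] sends the grid to 0, so the distance to 0 recovers the coordinate [t]
    of [u + t / m] for [0 <= t <= 1/2]. Being defined on the circle itself, it is continuous without
    gluing over cells. *)
Definition wild_map p : circle R :=
  step_map p + pi (sawsup (mdist (p *+ M.+1) 0) / m).

Lemma wild_map_near p : mdist (step_map p) (wild_map p) <= m^-1.
Proof.
rewrite /wild_map -{1}[step_map p]addr0 circle_mdistDl.
have := circle_mdist_pi 0 (sawsup (mdist (p *+ M.+1) 0) / m).
rewrite circle_pi0 => /le_trans; apply; rewrite sub0r normrN.
have /andP[w0 w1] := sawsup_itv (mdist (p *+ M.+1) 0).
rewrite ger0_norm; last by rewrite divr_ge0// ltW.
by rewrite ler_pdivrMr// mulVf//; lra.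
Qed.

Lemma wild_map_continuous : continuous wild_map.
Proof.
apply: continuous_circle_map => e e0.
pose d := (e / 2) ^+ 2 / 4.
have d0 : 0 < d by rewrite divr_gt0// exprn_gt0// divr_gt0.
exists (Num.min (e / 2 / (2 * m)) (d / m)).
  rewrite lt_min; apply/andP; split; last exact: divr_gt0.
  by apply: divr_gt0; [exact: divr_gt0|exact: mulr_gt0].
move=> p q; rewrite lt_min => /andP[pq1 pq2].
apply: le_lt_trans (circle_mdistD _ _ _ _) _.
have h1 : mdist (step_map p) (step_map q) < e / 2.
  apply: le_lt_trans (step_map_lip _ _) _.
  by rewrite -ltr_pdivlMl ?mulr_gt0// [X in _ < X]mulrC.
suff h2 : mdist (pi (sawsup (mdist (p *+ M.+1) 0) / m))
    (pi (sawsup (mdist (q *+ M.+1) 0) / m)) <= e / 2.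
  by move: h1 h2; lra.
apply: le_trans (circle_mdist_pi _ _) _; rewrite -mulrBl normrM.
rewrite (@ger0_norm _ m^-1) ?invr_ge0 ?(ltW m0)// ler_pdivrMr//.
apply: (@le_trans _ _ (e / 2)); last by rewrite ler_peMr ?ler1n// divr_ge0// ltW.
apply: sawsup_hoelder; first by rewrite divr_gt0.
apply: le_trans (circle_mdist0_lip _ _) _; apply: le_trans (circle_mdistMn _ _ _) _.
by move: pq2; rewrite ltr_pdivlMr// mulr_natr => /ltW.
Qed.

Lemma wild_map_lower_mdim :
  (forall u, exists k, A u = grid k) -> ((4^-1 : R)%:E <= lower_mdim wild_map)%E.
Proof.
(* The base orbit is the [A]-orbit of 0, which stays on the grid. For [t <= 1/2] the step map is
   constant next to it, so only the sawtooth moves [t]. *)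
move=> gridA; pose u j := iter j A 0.
have gridu j : exists k, u j = grid k.
  by case: j => [|j]; [exists 0; rewrite /grid mul0r circle_pi0|exact: gridA].
apply: (@saw_orbit_lower_mdim _ _ m u); first by rewrite ler1n.
move=> j t /andP[t0 t1]; have [k uk] := gridu j.
have pE : u j + pi (t / m) = pi ((k%:~R + t) / m) by rewrite uk -circle_piD -mulrDl.
have mE : m * ((k%:~R + t) / m) = k%:~R + t by rewrite mulrCA divff// mulr1.
rewrite pE /wild_map step_mapE (@step_lift_cell k); last by rewrite mE; lra.
rewrite mE [X in ramp X]addrAC subrr add0r ramp_eq0; last by lra.
rewrite mul0r circle_pi0 addr0 -uk; congr (_ + pi (sawsup _ / _)).
rewrite -circle_piMn -[_ / _ *+ _]mulr_natl mE circle_piD circle_pi_int ?intr_int// add0r.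
by rewrite -circle_pi0 circle_mdist_pi_small subr0 ger0_norm//; lra.
Qed.

End step_map.

(** * Approximation of an arbitrary circle map by both kinds of maps *)

Section dense_maps.
Variable R : realType.
Local Notation pi := (\pi_(circle R)).

Lemma grid_near (M : nat) (p : circle R) :
  exists k, mdist p (grid R M k) <= M.+1%:R^-1.
Proof.
have [x _ <-] := circle_pi_01 p; pose m : R := M.+1%:R.
have m0 : 0 < m by rewrite ltr0n.
exists (Num.floor (m * x)); apply: le_trans (circle_mdist_pi _ _) _.
have /andP[k1] := floor_itv (m * x); rewrite intrD => k2.
rewrite -/m -(ler_pM2l m0) divff ?gt_eqF// -[X in X * _](ger0_norm (ltW m0)) -normrM.
by rewrite mulrBr mulrCA divff ?gt_eqF// mulr1 ler_norml; lra.
Qed.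

Lemma C0_circle_dense (phi : C0_circle R) (e : R) : 0 < e ->
  exists f g : C0_circle R,
    [/\ mdist phi f < e, mdist phi g < e,
        (upper_mdim f <= 0)%E & ((4^-1 : R)%:E <= lower_mdim g)%E].
Proof.
(* The errors add up to [a + 4 * a + a] for the step map and one more [a] for the sawtooth, all
   below [8 * a <= e]; the minimum with 1 ensures [4 * a <= 1], as the bound on [s] requires. *)
move=> e0; pose a := Num.min 1 e / 8.
have a0 : 0 < a by rewrite divr_gt0// lt_min ltr01.
have a1 : a <= 8^-1 by rewrite /a -[X in _ <= X]mul1r ler_pM2r// ge_min lexx.
have ae : a <= e / 8 by rewrite /a ler_pM2r// ge_min lexx orbT.
have [d d0 phid] := circle_unif_continuous (@cts_fun _ _ phi) a0.
pose M := Num.trunc (a^-1 + d^-1).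
have m0 : 0 < M.+1%:R :> R by rewrite ltr0n.
have Mad : a^-1 + d^-1 < M.+1%:R by exact: truncnS_gt.
have ma : M.+1%:R^-1 <= a.
  rewrite -[a]invrK lef_pV2 ?posrE ?invr_gt0//; apply: le_trans (ltW Mad).
  by rewrite lerDl invr_ge0 ltW.
have md : M.+1%:R^-1 < d.
  rewrite -[d]invrK ltf_pV2 ?posrE ?invr_gt0//; apply: le_lt_trans Mad.
  by rewrite lerDr invr_ge0 ltW.
have /choice[r rP] p := grid_near M (phi p).
pose A p : circle R := grid R M (r p).
have phiA u : mdist (phi u) (A u) <= a by exact: le_trans (rP _) ma.
(* Neighbouring values of [A] are less than [3 * a] apart: two roundings and one oscillation of
   [phi]. Hence the increment has a lift shorter than [4 * a]. *)
have /choice[s sP] u : exists s : R, pi s = A (u + pi M.+1%:R^-1) - A u /\ `|s| <= 4 * a.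
  have [|x [y [<- <- xy]]] := @circle_mdist_lt _ (A (u + pi M.+1%:R^-1)) (A u) (4 * a).
    have phiu : mdist (phi (u + pi M.+1%:R^-1)) (phi u) < a.
      apply: phid; rewrite -{2}[u]addr0 circle_mdistDl -circle_pi0.
      apply: le_lt_trans (circle_mdist_pi _ _) _.
      by rewrite subr0 ger0_norm// invr_ge0 ltW.
    have := metric_triangle (A (u + pi M.+1%:R^-1)) (phi (u + pi M.+1%:R^-1)) (A u).
    have := metric_triangle (phi (u + pi M.+1%:R^-1)) (phi u) (A u).
    have := phiA (u + pi M.+1%:R^-1); have := phiA u.
    rewrite (metric_sym (A (u + _)) (phi _)).
    by move: phiu a0; clear; lra.
  by exists (x - y); rewrite circle_piB; split => //; exact: ltW.
have sA u : pi (s u) = A (u + pi M.+1%:R^-1) - A u by have [] := sP u.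
have sa u : `|s u| <= 4 * a by have [] := sP u.
have s1 u : `|s u| <= 1 by have := sa u; move: a1; clear; lra.
have phim p q : mdist p q <= M.+1%:R^-1 -> mdist (phi p) (phi q) <= a.
  by move=> pq; apply/ltW/phid; exact: le_lt_trans md.
have near := step_map_near sA phiA sa phim.
exists (mk_C0_circle (step_map_continuous sA s1)),
  (mk_C0_circle (wild_map_continuous sA s1)); split.
- apply: (@le_lt_trans _ _ (6 * a)); last by move: ae e0; clear; lra.
  apply: C0_dist_lub => p; apply: le_trans (near p) _.
  by clear; lra.
- apply: (@le_lt_trans _ _ (7 * a)); last by move: ae e0; clear; lra.
  apply: C0_dist_lub => p.
  apply: le_trans (metric_triangle _ (step_map M A s p) _) _.
  apply: le_trans (lerD (near p) (wild_map_near M A s p)) _.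
  have -> : 7 * a = a + 4 * a + a + a by ring.
  by rewrite lerD2l.
- exact: step_map_upper_mdim sA s1.
- by apply: (wild_map_lower_mdim sA) => u; exists (r u).
Qed.

End dense_maps.

(** * Discontinuity from a gap between nearby values *)

Lemma near_values_not_continuous (R : realType) (X : metricType R)
    (F : X -> \bar R) (x : X) (a b : \bar R) : (a < b)%E ->
  (forall e : R, 0 < e -> exists y z,
     [/\ mdist x y < e, mdist x z < e, (F y <= a)%E & (b <= F z)%E]) ->
  ~ {for x, continuous F}.
Proof.
move=> ab yz Fx.
have near U : nbhs (F x) U -> exists y z, [/\ U (F y), U (F z), (F y <= a)%E & (b <= F z)%E].
  move=> /Fx/nbhs_ballP[e /= e0]; rewrite ballEmdist => eU.
  by have [y [z [xy xz ya bz]]] := yz e e0; exists y, z; split => //; exact: eU.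
(* If [F x < b], the open ray below [b] excludes the values [F z]; otherwise [a < b <= F x], and the
   open ray above [a] excludes the values [F y]. *)
have [Fb|bF] := ltP (F x) b.
  have [_ [z [_ /= Fzb _]]] : exists y z, [/\ [set v | (v < b)%E] (F y),
      [set v | (v < b)%E] (F z), (F y <= a)%E & (b <= F z)%E].
    by apply: near; apply: open_nbhs_nbhs; split => //; exact: open_ereal_lt_ereal.
  by rewrite leNgt Fzb.
have [y [_ [/= aFy _ + _]]] : exists y z, [/\ [set v | (a < v)%E] (F y),
    [set v | (a < v)%E] (F z), (F y <= a)%E & (b <= F z)%E].
  apply: near; apply: open_nbhs_nbhs; split; first exact: open_ereal_gt_ereal.
  exact: lt_le_trans bF.
by rewrite leNgt aFy.
Qed.

Lemma lower_mdim_le_upper_mdim (R : realType) (X : metricType R) (phi : X -> X) :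
  (lower_mdim phi <= upper_mdim phi)%E.
Proof.
rewrite /lower_mdim /upper_mdim limf_einfE limf_esupE.
apply: ge_ereal_sup => _ [V V0 <-]; apply: le_ereal_inf_tmp => _ [W W0 <-].
have [eps [Veps Weps]] : V `&` W !=set0 by apply: (@filter_ex _ (0 : R)^'+); exact: filterI.
apply: (@le_trans _ _ (sep_rate phi eps * (`|ln eps|^-1)%:E)%E).
  by apply: ereal_inf_lbound; exists eps.
by apply: ereal_sup_ubound; exists eps.
Qed.

Theorem corollary4p8 (R : realType) :
  (forall phi : C0_circle R,
     ~ {for phi, continuous (fun psi : C0_circle R => lower_mdim psi)})
  /\
  (forall phi : C0_circle R,
     ~ {for phi, continuous (fun psi : C0_circle R => upper_mdim psi)}).
Proof.
(* One pair of approximants serves both claims: [lower_mdim_le_upper_mdim] carries the bound 0 down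
   to the lower dimension and the bound 1/4 up to the upper one. *)
have quarter_gt0 : (0 < (4^-1 : R)%:E)%E by rewrite lte_fin invr_gt0.
split=> phi; apply: (near_values_not_continuous quarter_gt0) => e /(C0_circle_dense phi).
  move=> [f [g [phif phig f0 g4]]]; exists f, g; split => //.
  exact: le_trans (lower_mdim_le_upper_mdim _) f0.
move=> [f [g [phif phig f0 g4]]]; exists f, g; split => //.
exact: le_trans g4 (lower_mdim_le_upper_mdim _).
Qed.
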